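(* Let $t(n)$ be a sequence of natural numbers, let $\mathrm{GF}_t(z)=\sum_{i=0}^\infty t(i)z^i$ and let $R$ be the radius of convergence of $\mathrm{GF}_t(z)$ at zero. Let $b$ and $n$ be positive integers such that $b\ge 8$, $b^{-1}<R$, and $t(r)<b^{r/3}$ for every integer $r\ge 1$. Then $$t(n)=\left\lfloor b^{n^2}\,\mathrm{GF}_t(b^{-n})\right\rfloor \bmod b^n .$$
   Context: Natural numbers are the non-negative integers. $\mathrm{GF}_t(b^{-n})$ denotes the (real) sum of the power series $\sum_{i\ge 0} t(i) b^{-ni}$. For an integer $y\ge 1$, $x \bmod y$ denotes the least non-negative residue of $x$ modulo $y$. *)

(* Defs.v *)
From Stdlib Require Import Reals ZArith.
From Coquelicot Require Import Coquelicot.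

Open Scope R_scope.

Definition GF_coef (t : nat -> nat) : nat -> R := fun i => INR (t i).

Definition GF (t : nat -> nat) (z : R) : R := PSeries (GF_coef t) z.

(* Possibly [p_infty], e.g. when [t] is eventually zero. *)
Definition GF_radius (t : nat -> nat) : Rbar := CV_radius (GF_coef t).

(* Main.v *)
Require Import Defs.
From Stdlib Require Import Reals ZArith Lra Lia.
From Coquelicot Require Import Coquelicot.

Open Scope R_scope.

(** Put [B = b ^ n], so that [b ^ (n ^ 2) = B ^ n]. In [B ^ n * GF t (/ B)] the
    terms of index [i < n] are the multiples [t i * B ^ (n - i)] of [B] and the term
    of index [n] is [t n]. With [c = b ^ (1/3)] we have [t i < c ^ i] for [i >= 1], so
    the terms of index [i > n] are dominated by a geometric series and add up to at
    most [c ^ (n + 1) / (B - c)]. As [B = c ^ (3 n)] and [c >= 2], this is less than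
    [1] and the floor discards it; likewise [t n < c ^ n <= B]. *)

Lemma Series_geom_bounds (u : nat -> R) (M q : R) :
  0 <= q < 1 -> (forall k, 0 <= u k <= M * q ^ k) ->
  ex_series u /\ 0 <= Series u <= M / (1 - q).
Proof.
intros Hq Hu.
assert (Hgeom : is_series (fun k => M * q ^ k) (M / (1 - q))).
{ apply (is_series_scal_l M (fun k => q ^ k)), is_series_geom.
  rewrite Rabs_pos_eq; lra. }
assert (Hex : ex_series u).
{ apply (ex_series_le u (fun k => M * q ^ k)); [| now exists (M / (1 - q))].
  intros k; change (Rabs (u k) <= M * q ^ k); rewrite Rabs_pos_eq; apply Hu. }
split; [exact Hex | split].
- rewrite <- (Rmult_0_l (Series u)), <- Series_scal_l.
  apply Series_le; [| exact Hex].
  intros k; specialize (Hu k); lra.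
- rewrite <- (is_series_unique _ _ Hgeom).
  apply Series_le; [exact Hu | now exists (M / (1 - q))].
Qed.

Lemma Series_remainder_geom_bounds (u : nat -> R) (M q : R) (n : nat) :
  0 <= q < 1 -> (forall k, (n < k)%nat -> 0 <= u k <= M * q ^ k) ->
  0 <= Series u - sum_f_R0 u n <= M * q ^ S n / (1 - q).
Proof.
intros Hq Hu.
destruct (Series_geom_bounds (fun k => u (S n + k)%nat) (M * q ^ S n) q Hq)
  as [Hex Hbounds].
{ intros k; rewrite Rmult_assoc, <- pow_add; apply Hu; lia. }
rewrite (Series_incr_n u (S n)) by (lia || now apply ex_series_incr_n in Hex).
simpl pred; lra.
Qed.

Fixpoint horner (t : nat -> nat) (B n : nat) : nat :=
  match n with
  | O => t O
  | S m => horner t B m * B + t (S m)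
  end.

Lemma INR_horner (t : nat -> nat) (B n : nat) :
  (0 < B)%nat ->
  INR (horner t B n) = INR B ^ n * sum_f_R0 (fun i => INR (t i) * (/ INR B) ^ i) n.
Proof.
intros HB; apply lt_0_INR in HB.
induction n as [| n IH].
- simpl; ring.
- change (horner t B (S n)) with (horner t B n * B + t (S n))%nat.
  rewrite plus_INR, mult_INR, IH, tech5, pow_inv, <- !tech_pow_Rmult.
  field; split; [apply pow_nonzero |]; lra.
Qed.

Lemma horner_mod (t : nat -> nat) (B n : nat) :
  (horner t B n mod B = t n mod B)%nat.
Proof.
destruct n as [| n]; [reflexivity |].
simpl horner; rewrite Nat.add_comm; apply Nat.Div0.mod_add.
Qed.

Section ExponentialGrowth.

Variables (t : nat -> nat) (B n : nat) (M c : R).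
Hypothesis c_ge_0 : 0 <= c.
Hypothesis c_lt_B : c < INR B.
Hypothesis t_le : forall r, (n < r)%nat -> INR (t r) <= M * c ^ r.

Lemma scaled_GF_bounds :
  INR (horner t B n) <= INR B ^ n * GF t (/ INR B)
    <= INR (horner t B n) + M * c ^ S n / (INR B - c).
Proof.
assert (HB : 0 < INR B) by lra.
assert (HBn : 0 < INR B ^ n) by now apply pow_lt.
set (u := fun i => INR (t i) * (/ INR B) ^ i).
assert (Hu : forall r, (n < r)%nat -> 0 <= u r <= M * (c / INR B) ^ r).
{ intros r Hr; unfold u, Rdiv; rewrite Rpow_mult_distr, <- Rmult_assoc.
  assert (Hinv : 0 <= (/ INR B) ^ r)
    by now apply pow_le, Rlt_le, Rinv_0_lt_compat.
  split.
  - apply Rmult_le_pos; [apply pos_INR | exact Hinv].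
  - apply Rmult_le_compat_r; [exact Hinv | now apply t_le]. }
assert (Hratio : 0 <= c / INR B < 1).
{ split; [now apply Rdiv_le_0_compat |].
  apply Rlt_div_l; lra. }
pose proof (Series_remainder_geom_bounds u M _ n Hratio Hu) as Hrem.
assert (Hscale : M * c ^ S n / (INR B - c)
  = INR B ^ n * (M * (c / INR B) ^ S n / (1 - c / INR B))).
{ unfold Rdiv; rewrite Rpow_mult_distr, pow_inv, <- !tech_pow_Rmult.
  field; repeat split; lra. }
rewrite INR_horner, Hscale by now apply INR_lt.
change (GF t (/ INR B)) with (Series u); fold u.
split; nra.
Qed.

Lemma Zfloor_scaled_GF :
  M * c ^ S n < INR B - c ->
  Zfloor (INR B ^ n * GF t (/ INR B)) = Z.of_nat (horner t B n).
Proof.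
intros Hsmall.
assert (Htail : M * c ^ S n / (INR B - c) < 1) by (apply Rlt_div_l; lra).
pose proof scaled_GF_bounds.
apply Zfloor_eq; rewrite <- INR_IZR_INZ; lra.
Qed.

Lemma coef_eq_Zfloor_GF_mod :
  M * c ^ S n < INR B - c -> (t n < B)%nat ->
  Z.of_nat (t n) = (Zfloor (INR B ^ n * GF t (/ INR B)) mod Z.of_nat B)%Z.
Proof.
intros Hsmall Htn.
rewrite Zfloor_scaled_GF by exact Hsmall.
now rewrite <- Nat2Z.inj_mod, horner_mod, Nat.mod_small.
Qed.

End ExponentialGrowth.

Lemma Rpower_mult_INR (x y : R) (r : nat) : Rpower x (y * INR r) = Rpower x y ^ r.
Proof.
rewrite <- Rpower_mult; apply Rpower_pow, exp_pos.
Qed.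

Lemma Rpower_inv_INR_pow (x : R) (m : nat) :
  0 < x -> (0 < m)%nat -> Rpower x (/ INR m) ^ m = x.
Proof.
intros Hx Hm; apply lt_0_INR in Hm.
rewrite <- Rpower_mult_INR, Rinv_l by lra.
now apply Rpower_1.
Qed.

Lemma Rpower_inv_INR_ge (x y : R) (m : nat) :
  0 < y -> (0 < m)%nat -> y ^ m <= x -> y <= Rpower x (/ INR m).
Proof.
intros Hy Hm Hyx; apply lt_0_INR in Hm.
replace y with (Rpower (y ^ m) (/ INR m)) at 1.
- apply Rle_Rpower_l; [now apply Rlt_le, Rinv_0_lt_compat |].
  split; [now apply pow_lt | exact Hyx].
- rewrite <- Rpower_pow, Rpower_mult, Rinv_r by lra.
  now apply Rpower_1.
Qed.

Lemma pow_S_plus_lt_pow_triple (c : R) (n : nat) :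
  2 <= c -> (0 < n)%nat -> c ^ S n + c < c ^ (3 * n).
Proof.
intros Hc Hn.
assert (Hc_le : c <= c ^ n) by (rewrite <- (pow_1 c) at 1; apply Rle_pow; lra || lia).
rewrite <- tech_pow_Rmult, Nat.mul_comm, pow_mult.
set (x := c ^ n) in *.
apply Rle_lt_trans with (x ^ 2 + x); nra.
Qed.

Theorem theorem4p2 (t : nat -> nat) (b n : nat)
  (hb0 : (0 < b)%nat) (hn0 : (0 < n)%nat)
  (hb : (8 <= b)%nat)
  (hR : Rbar_lt (Finite (/ INR b)) (GF_radius t))
  (ht : forall r : nat, (1 <= r)%nat -> INR (t r) < Rpower (INR b) (INR r / 3)) :
  Z.of_nat (t n) =
    (Zfloor (INR b ^ (n ^ 2) * GF t (/ (INR b ^ n))) mod Z.of_nat (b ^ n))%Z.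
Proof.
assert (Hb : 2 ^ 3 <= INR b) by (apply le_INR in hb; simpl in *; lra).
set (c := Rpower (INR b) (/ INR 3)).
assert (Hc : 2 <= c) by (apply Rpower_inv_INR_ge; lra || lia).
assert (Hc3 : c ^ 3 = INR b) by (apply Rpower_inv_INR_pow; lra || lia).
assert (Htc : forall r, (1 <= r)%nat -> INR (t r) < c ^ r).
{ intros r Hr; unfold c; rewrite <- Rpower_mult_INR.
  replace (/ INR 3 * INR r) with (INR r / 3) by (simpl; field).
  now apply ht. }
assert (HB : INR (b ^ n) = c ^ (3 * n)) by now rewrite pow_INR, pow_mult, Hc3.
pose proof (pow_S_plus_lt_pow_triple c n Hc hn0) as Hsmall.
assert (Hpow_n : 0 <= c ^ n <= c ^ S n)
  by (split; [apply pow_le | apply Rle_pow]; lra || lia).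
rewrite Nat.pow_2_r, pow_mult, <- pow_INR.
apply (coef_eq_Zfloor_GF_mod t (b ^ n) n 1 c).
- lra.
- lra.
- intros r Hr; rewrite Rmult_1_l; apply Rlt_le, Htc; lia.
- lra.
- apply INR_lt; specialize (Htc n hn0); lra.
Qed.
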